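(* Let $\tau>0$, and let $\mu_\tau$ be the compactly supported probability measure on $[0,1]$ with $S$-transform $S_{\mu_\tau}(z)=\exp\left(\frac{\tau}{1+z}\right)$. Then: (i) $\mu_\tau(\{1\})=(1-\tau)_+$, where $x_+=\max\{x,0\}$. Consequently $\mu_\tau([0,1]\setminus\{1\})=\min\{1,\tau\}$. (ii) The Stieltjes-transform equation $$z=z(h)=\frac{h\,e^{-\tau/h}}{h-1}$$ has a real branch point at $x_*(\tau)=\tau e^{1-\tau}$; that is, for $\tau\neq1$ there is a real $h_*\notin\{0,1\}$ with $\frac{dz}{dh}(h_* )=0$ and $z(h_* )=\tau e^{1-\tau}$, and for $\tau=1$ the value $x_*(1)$ is understood by continuous extension in $\tau$. (iii) At $\tau=1$ the branch point reaches $1$, i.e. $x_*(1)=1$, precisely where the atom of $\mu_\tau$ at $1$ disappears (the atom has positive mass for $0<\tau<1$ and zero mass for $\tau\ge1$).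
   Context: The $S$-transform of a compactly supported probability measure $\mu\neq\delta_0$ on $[0,\infty)$ is defined near $0$ by $S_\mu(w)=\frac{1+w}{w}\psi_\mu^{-1}(w)$, where $\psi_\mu(z)=\sum_{p\ge1}z^p\int x^p\,d\mu(x)$ and $\psi_\mu^{-1}$ is the compositional inverse near $0$. For every $\tau>0$ there is exactly one compactly supported probability measure $\mu_\tau$ on $[0,1]$ with the stated $S$-transform; it is the weak limit as $n\to\infty$ of the free multiplicative convolution powers $\nu_{\tau/n}^{\boxtimes n}$, where $\nu_c=(1-c)\delta_1+c\delta_0$. With $G_\tau(z)=\int_0^1\frac{1}{z-x}\,d\mu_\tau(x)$ and $h(z)=zG_\tau(z)$, the Stieltjes transform satisfies the equation $z=\frac{h e^{-\tau/h}}{h-1}$ (the Stieltjes-transform equation). A branch point of the inverse map is a value $z(h)$ at a point where $dz/dh=0$. *)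

(* Defs.v *)
From mathcomp Require Export all_boot all_order all_algebra.
From mathcomp Require Export all_classical all_reals all_analysis.
Export Order.TTheory GRing.Theory Num.Theory.
Export numFieldNormedType.Exports.

Set Implicit Arguments.
Unset Strict Implicit.
Unset Printing Implicit Defensive.

#[global] Open Scope classical_set_scope.
#[global] Open Scope ring_scope.

Definition psi (R : realType) (mu : probability (measurableTypeR R) R)
    (z : R) : R :=
  \big[+%R/0]_(1 <= p <oo) (z ^+ p * \int[mu]_x (x ^+ p)).

(* [g] is the germ at 0 of the compositional inverse of [f] (with f 0 = 0). *)
Definition inverse_near0 (R : realType) (f g : R -> R) : Prop :=
  [/\ g 0 = 0, {for 0, continuous g},
      \forall w \near (0 : R), f (g w) = w
    & \forall z \near (0 : R), g (f z) = z].

(* The S-transform is a germ at 0, so this is a relation rather than a chosen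
   function.  [S] and the measure's own S-transform are compared on a punctured
   neighbourhood of 0, since the factor (1 + w) / w has a removable singularity
   there.  Real arguments suffice: S-transforms are analytic at 0. *)
Definition has_S_transform (R : realType)
    (mu : probability (measurableTypeR R) R) (S : R -> R) : Prop :=
  mu [set (0 : R)] != 1%E /\
  exists2 chi : R -> R, inverse_near0 (psi mu) chi
    & \forall w \near (0 : R)^', S w = (1 + w) / w * chi w.

(* The inverse map of the Stieltjes-transform equation, h = z * G(z). *)
Definition zmap (R : realType) (tau h : R) : R :=
  h * expR (- (tau / h)) / (h - 1).

(* The singularities h = 0, 1 are excluded explicitly: division is total. *)
Definition real_branch_point (R : realType) (tau x : R) : Prop :=
  exists h : R, [/\ h != 0, h != 1,
    is_derive h (1 : R) (zmap tau) 0 & zmap tau h = x].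

Definition xstar (R : realType) (tau : R) : R := tau * expR (1 - tau).

(* Main.v *)
Require Import Defs.
From mathcomp Require Import measurable_realfun ring lra.

(** Write [psi] for the moment series of [mu] and [a] for the mass of [mu]
at [1].

The moments of [mu] decrease to [a], so by Abel's theorem
[(1 - z) * (1 + psi z)] tends to [a] as [z] tends to [1] from below
([cvg_psi_atom]); the atom is thus read off from [psi] near [1].  The
S-transform, however, only describes [psi] near [0]: there it says
  [psi z * expR (tau / (1 + psi z)) = z * (1 + psi z)],
which is the Stieltjes-transform equation for [h = 1 + psi z] at [1 / z].
The main point is to carry this equation from [0] up to [1].

Comparing power series directly would require composing them with the
exponential.  Instead, differentiating the equation and eliminating the exponential yields the
algebraic differential equation
  [z * psi' * (1 + (1 - tau) * psi) = psi * (1 + psi) ^+ 2]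
near [0].  Both sides are sums of power series converging on the unit disc,
hence the differential equation holds on the whole disc by the identity
principle ([unit_pseries_identity]).  Conversely, it says that the quotient of
the two sides of the original equation has zero derivative on ]0, 1[, and this
quotient is [1] near [0] ([functional_equation]).

With [h = 1 + psi z >= 1], the equation reads [z = (1 - 1 / h) * expR (tau / h)].
The elementary bounds on the exponential give [(1 - z) * h >= 1 - tau] when
[tau < 1], and [(1 - z) * h <= 1 - tau + tau / h] always.  Multiplying the
second one by [(1 - z) * h] turns [tau / h] into [tau * (1 - z)], which vanishes
in the limit whatever [h] does.  So [a >= 1 - tau] when [tau < 1], and
[a ^+ 2 <= (1 - tau) * a], which leaves only [a = max (1 - tau, 0)].

The branch point comes from the logarithmic derivative of [zmap tau], whose
only zero, for [tau != 1], is [h = tau / (tau - 1)]. *)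

Set Implicit Arguments.
Unset Strict Implicit.
Unset Printing Implicit Defensive.

(** * Sums of power series on the open unit interval *)

(** The coefficients are hidden under an existential, so that closure under the
ring operations and differentiation can be used without computing them. *)
Definition unit_pseries (R : realType) (f : R -> R) :=
  exists a : R^nat, forall z, `|z| < 1 -> pseries a z @ \oo --> f z.

Section PowerSeries.
Variable R : realType.
Implicit Types (a b : R^nat) (f g : R -> R) (r z : R).

Lemma exists_between_norm z : `|z| < 1 -> exists2 r, `|z| < r & r < 1.
Proof. by move=> z1; exists ((`|z| + 1) / 2); lra. Qed.

Lemma near_norm_lt1 z : `|z| < 1 -> \forall y \near z, `|y| < 1.
Proof.
move=> z1; apply: (@cvgr_norm_lt _ R^o _ (nbhs z) _ id z _ 1 z1).
exact: cvg_id.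
Qed.

Lemma eq_unit_pseries f g : (forall z, `|z| < 1 -> f z = g z) ->
  unit_pseries f -> unit_pseries g.
Proof. by move=> fg [a af]; exists a => z z1; rewrite -fg//; exact: af. Qed.

Lemma unit_pseries_cst (c : R) : unit_pseries (fun=> c).
Proof.
exists (fun n => c *+ (n == 0)) => z _; rewrite -cvg_shiftS.
apply: cvg_near_cst; near=> n.
rewrite /pseries /series /= big_nat_recl//= expr0 mulr1 big1 ?addr0//.
by move=> i _; rewrite mulr0n mul0r.
Unshelve. all: by end_near. Qed.

Lemma unit_pseries_id : unit_pseries (fun z : R => z).
Proof.
exists (fun n => (n == 1)%:R) => z _; rewrite -(cvg_shiftn 2).
apply: cvg_near_cst; near=> n.
rewrite /pseries /series /= addn2 !big_nat_recl//= mul0r mul1r add0r expr1.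
by rewrite big1 ?addr0// => i _; rewrite mul0r.
Unshelve. all: by end_near. Qed.

Lemma unit_pseriesD f g :
  unit_pseries f -> unit_pseries g -> unit_pseries (fun z => f z + g z).
Proof.
move=> [a af] [b bg]; exists (fun n => a n + b n) => z z1.
rewrite (_ : pseries _ _ = pseries a z \+ pseries b z).
  by apply: cvgD; [exact: af|exact: bg].
apply/funext => n; rewrite /pseries /series /= -big_split/=.
by apply: eq_bigr => i _; rewrite mulrDl.
Qed.

Definition convolution a b : R^nat :=
  fun n => \sum_(i < n.+1) a i * b (n - i)%N.

(* Partial sums are evaluated polynomials: this gives their products for free. *)
Let trunc a n : {poly R} := \poly_(i < n) a i.

Let truncE a n z : (trunc a n).[z] = pseries a z n.
Proof. by rewrite /trunc horner_poly /pseries /series /= big_mkord. Qed.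

Lemma pseries_bounded a r : cvgn (pseries a r) ->
  exists M, forall n, pseries a r n <= M.
Proof.
move=> /cvg_seq_bounded/bounded_fun_has_ubound[M aM].
by exists M => n; apply: aM; exists n.
Qed.

(** The coefficients below [n] of the product of the [n]-th truncations are those
of the convolution.  Only monomials of degree at least [n] remain, and going
from radius [r] down to [`|z|] scales each of them by at most
[(`|z| / r) ^+ n]; hence no tail of a double series needs to be estimated. *)
Lemma pseries_mul_tail a b r z n : `|z| <= r -> 0 < r ->
  `|pseries a z n * pseries b z n - pseries (convolution a b) z n| <=
  (`|z| / r) ^+ n *
  (pseries (fun i => `|a i|) r n * pseries (fun i => `|b i|) r n).
Proof.
move=> zr r0.
have r0' := ltW r0.
pose na := fun i => `|a i|; pose nb := fun i => `|b i|.
have sizeM c d : (size (trunc c n * trunc d n)%R <= n + n)%N.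
  rewrite (leq_trans (size_polyMleq _ _))// (leq_trans (leq_pred _))//.
  by rewrite leq_add// size_poly.
have low : pseries (convolution a b) z n =
    \sum_(i < n) (trunc a n * trunc b n)`_i * z ^+ i.
  rewrite /pseries /series /= big_mkord; apply: eq_bigr => i _.
  rewrite coefM; congr (_ * _); apply: eq_bigr => j _; rewrite !coef_poly.
  rewrite (leq_ltn_trans (leq_subr _ _) (ltn_ord i)).
  by rewrite (leq_ltn_trans _ (ltn_ord i))// -ltnS.
rewrite low -!truncE -!hornerM (horner_coef_wide _ (sizeM _ _)).
rewrite [in leRHS](horner_coef_wide _ (sizeM _ _)).
rewrite !big_split_ord/= [X in `|X|]addrAC subrr add0r.
rewrite (le_trans (ler_norm_sum _ _ _))//.
have coefle k : `|(trunc a n * trunc b n)`_k| <= (trunc na n * trunc nb n)`_k.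
  rewrite !coefM (le_trans (ler_norm_sum _ _ _))// ler_sum// => j _.
  by rewrite normrM ler_pM// !coef_poly; case: ifP => //; rewrite normr0.
have coef0 k : 0 <= (trunc na n * trunc nb n)`_k.
  exact: le_trans (coefle k).
rewrite mulrDr -[leLHS]add0r lerD//.
  rewrite mulr_ge0 ?exprn_ge0 ?divr_ge0// sumr_ge0// => i _.
  by rewrite mulr_ge0 ?exprn_ge0.
rewrite mulr_sumr ler_sum// => i _.
rewrite normrM normrX mulrCA ler_pM ?exprn_ge0//.
rewrite !exprD expr_div_n mulrA divfK ?expf_neq0 ?gt_eqF//.
by rewrite ler_wpM2l ?exprn_ge0// lerXn2r// nnegrE.
Qed.

Lemma unit_pseries_cvg_norm a f r : 
  (forall z, `|z| < 1 -> pseries a z @ \oo --> f z) -> 0 <= r < 1 ->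
  cvgn (pseries (fun i => `|a i|) r).
Proof.
move=> af /andP[r0 r1].
have [s rs s1] : exists2 s, `|r| < s & s < 1.
  by apply: exists_between_norm; rewrite ger0_norm.
have s0 : 0 <= s by rewrite ltW// (le_lt_trans _ rs).
apply: (@is_cvg_pseries_inside_norm _ _ s); last by rewrite (ger0_norm s0).
by apply/cvg_ex; exists (f s); apply: af; rewrite ger0_norm.
Qed.

Lemma unit_pseriesM f g :
  unit_pseries f -> unit_pseries g -> unit_pseries (fun z => f z * g z).
Proof.
move=> [a af] [b bg]; exists (convolution a b) => z z1.
have [r zr r1] := exists_between_norm z1.
have r0 : 0 < r by rewrite (le_lt_trans _ zr).
have r01 : 0 <= r < 1 by rewrite ltW.
have [Ma aM] := pseries_bounded (unit_pseries_cvg_norm af r01).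
have [Mb bM] := pseries_bounded (unit_pseries_cvg_norm bg r01).
have ps0 c n : 0 <= pseries (fun i => `|c i|) r n.
  by rewrite /pseries /series /= sumr_ge0// => i _; rewrite mulr_ge0 ?exprn_ge0// ltW.
have fg : pseries a z n * pseries b z n @[n --> \oo] --> f z * g z.
  by apply: cvgM; [exact: af|exact: bg].
have tail0 : (`|z| / r) ^+ n * (Ma * Mb) @[n --> \oo] --> (0 : R).
  rewrite -[X in _ --> X](mul0r (Ma * Mb)); apply: cvgMl.
  apply: cvg_expr; rewrite normrM normr_id normfV (gtr0_norm r0).
  by rewrite ltr_pdivrMr// mul1r.
apply: cvg_sub0 fg.
apply/norm_cvg0P.
apply: squeeze_cvgr (@cvg_cst _ _ _ _ _) tail0; near=> n.
rewrite normr_ge0/= /= distrC.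
apply: (le_trans (pseries_mul_tail _ _ _ _ r0)); first exact: ltW.
by apply: ler_wpM2l; rewrite ?ler_pM// exprn_ge0// divr_ge0// ltW.
Unshelve. all: by end_near. Qed.

(** This makes the derived series at [z] comparable with the original series at a
slightly larger radius [r]. *)
Lemma diff_coef_le z r n : 0 <= z <= r -> 
  n.+1%:R * z ^+ n * (r - z) <= r ^+ n.+1.
Proof.
move=> /andP[z0 zr]; have r0 := le_trans z0 zr.
elim: n => [|n IH]; first by rewrite expr0 expr1; lra.
have := ler_wpM2l z0 IH.
have : z ^+ n.+1 * (r - z) <= r ^+ n.+1 * (r - z).
  by rewrite ler_wpM2r ?subr_ge0// lerXn2r.
rewrite -(natr1 n.+1) ![_ ^+ n.+2]exprS !exprS.
move: (n.+1%:R) (z ^+ n) (r ^+ n) => N Z S; nra.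
Qed.

Lemma cvg_pseries_diffs a :
  (forall z, `|z| < 1 -> cvgn (pseries a z)) ->
  forall z, `|z| < 1 -> cvgn (pseries (pseries_diffs a) z).
Proof.
move=> ca z z1; have [r zr r1] := exists_between_norm z1.
have r0 : 0 < r by rewrite (le_lt_trans _ zr).
have car : cvgn (pseries (fun i => `|a i|) r).
  have r01 : 0 <= r < 1 by rewrite ltW.
  by apply: (@unit_pseries_cvg_norm a (fun z => limn (pseries a z))).
apply: normed_cvg.
apply: (@series_le_cvg _ _
  (fun n => (r - `|z|)^-1 * (`|a n.+1| * r ^+ n.+1))).
- by move=> n /=.
- move=> n /=; apply: mulr_ge0; first by rewrite invr_ge0 subr_ge0 ltW.
  by rewrite mulr_ge0 ?exprn_ge0// ltW.
- move=> n /=; rewrite /pseries_diffs/= !normrM normrX normr_nat.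
  rewrite [leRHS]mulrC ler_pdivlMr ?subr_gt0//.
  rewrite [_ * `|a _|]mulrC -!mulrA ler_wpM2l// mulrA.
  by rewrite diff_coef_le// normr_ge0 ltW.
- apply: is_cvg_seriesZ.
  rewrite (_ : series _ = fun n => pseries (fun i => `|a i|) r n.+1 - `|a 0%N|).
    apply: is_cvgB; last exact: is_cvg_cst.
    move/cvg_ex : car => [l al]; apply/cvg_ex; exists l.
    by rewrite (cvg_shiftS (pseries _ r)).
  apply/funext => n.
  by rewrite /pseries /series /= big_nat_recl//= expr0 mulr1 addrC addKr.
Qed.

Lemma is_derive_pseries a f :
  (forall z, `|z| < 1 -> pseries a z @ \oo --> f z) -> exists2 f',
  forall z, `|z| < 1 -> pseries (pseries_diffs a) z @ \oo --> f' z
  & forall z, `|z| < 1 -> is_derive z 1 f (f' z).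
Proof.
move=> af.
have ca z : `|z| < 1 -> cvgn (pseries a z).
  by move=> z1; apply/cvg_ex; exists (f z); exact: af.
exists (fun z => limn (pseries (pseries_diffs a) z)).
  by move=> z z1; exact: cvg_pseries_diffs ca _ z1.
move=> z z1; have [r zr r1] := exists_between_norm z1.
have r1' : `|r| < 1 by rewrite ger0_norm// (le_trans _ (ltW zr)).
apply: (@near_eq_is_derive _ _ _ (fun z => limn (pseries a z))).
- near=> y; apply/cvg_lim => //; apply: af.
  by near: y; exact: near_norm_lt1.
- apply: (@pseries_snd_diffs _ _ r).
  + exact: ca.
  + exact: cvg_pseries_diffs.
  + by do 2!apply: cvg_pseries_diffs => //.
  + by rewrite (lt_le_trans zr)// ler_norm.
Unshelve. all: by end_near. Qed.

Lemma is_derive_unit_pseries f : unit_pseries f -> exists2 f',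
  unit_pseries f' & forall z, `|z| < 1 -> is_derive z 1 f (f' z).
Proof.
by move=> [a /is_derive_pseries[f' af' ff']]; exists f' => //; exists (pseries_diffs a).
Qed.

Lemma pseries_at0 a : pseries a 0 @ \oo --> a 0%N.
Proof.
rewrite -cvg_shiftS; apply: cvg_near_cst; near=> n.
rewrite /pseries /series /= big_nat_recl//= expr0 mulr1 big1 ?addr0//.
by move=> i _; rewrite exprS mul0r mulr0.
Unshelve. all: by end_near. Qed.

(** The identity principle at [0].  The coefficients vanish one after the other: the
first one is the value at [0], and the others are, up to nonzero factors, the
coefficients of the derivative, which also vanishes near [0]. *)
Lemma unit_pseries_identity f : unit_pseries f ->
  (\forall z \near 0, f z = 0) -> forall z, `|z| < 1 -> f z = 0.
Proof.
move=> [a af] f0.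
suff a0 n : a n = 0.
  move=> z z1; apply: (cvg_unique _ (af z z1)) => //.
  apply: cvg_near_cst; near=> n.
  by rewrite /pseries /series /= big1// => i _; rewrite a0 mul0r.
elim: n a f af f0 => [|n IH] a f af f0.
  have := af 0; rewrite normr0 ltr01 => /(_ isT) /(cvg_unique _ (@pseries_at0 a)) ->//.
  exact: nbhs_singleton f0.
have [f' af' ff'] := is_derive_pseries af.
have := IH (pseries_diffs a) f' af'.
rewrite /pseries_diffs => /(_ _)/eqP; rewrite mulf_eq0 pnatr_eq0/= => H.
apply/eqP/H; near=> z.
have z1 : `|z| < 1.
  by near: z; apply: near_norm_lt1; rewrite normr0.
have [_ <-] := ff' z z1.
rewrite (@near_eq_derive R R^o R^o f (cst 0)) ?derive_cst//.
by near: z; apply: (near_join f0).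
Unshelve. all: by end_near. Qed.

End PowerSeries.

(** * Moments of a probability measure on the unit interval *)

Section Moments.
Variables (R : realType) (mu : probability (measurableTypeR R) R).
Hypothesis mu_supp : mu (`[0, 1]%classic : set R) = 1%E.

Let D : set (measurableTypeR R) := `[0, 1]%classic.
Let mD : measurable D. Proof. exact: measurable_itv. Qed.

Definition moment (p : nat) : R := \int[mu]_x (x ^+ p).

Let atom : R := fine (mu [set (1 : R)]).

Lemma atomE : mu [set (1 : R)] = atom%:E.
Proof. by rewrite /atom fineK// fin_num_measure. Qed.

Let measurable_pow p (A : set (measurableTypeR R)) :
  measurable_fun A (fun x : measurableTypeR R => ((x : R) ^+ p)%:E).
Proof.
by apply/measurable_EFinP; apply: measurable_funX; exact: measurable_id.
Qed.

Lemma integral_pow_supp p :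
  (\int[mu]_x (x ^+ p)%:E = \int[mu]_(x in D) (x ^+ p)%:E)%E.
Proof.
rewrite [RHS]integral_mkcond; apply: ae_eq_integral => //.
  by apply/(measurable_restrictT _ _).1.
exists (~` D); split.
- exact: measurableC.
- have := probability_setC mu mD; rewrite mu_supp subee//.
- move=> x /= H Dx; apply: H => _.
  by rewrite patchE mem_set.
Qed.

Let Dpow p x : D x -> 0 <= x ^+ p <= 1.
Proof.
by rewrite /D/= in_itv/= => /andP[x0 x1]; rewrite exprn_ge0// exprn_ile1.
Qed.

Let integrable1 : mu.-integrable D (cst 1%E).
Proof. by apply: finite_measure_integrable_cst. Qed.

Let integrable_pow p : mu.-integrable D (fun x => (x ^+ p)%:E).
Proof.
apply: le_integrable integrable1 => // x Dx; have /andP[x0 x1] := Dpow p Dx.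
by rewrite /= lee_fin normr1 ger0_norm.
Qed.

Lemma momentE p : (moment p)%:E = (\int[mu]_(x in D) (x ^+ p)%:E)%E.
Proof.
rewrite /moment /Rintegral integral_pow_supp fineK//.
exact: integrable_fin_num.
Qed.

Let integral_atom :
  (\int[mu]_(x in D) (\1_[set 1%R : measurableTypeR R] x)%:E)%E = atom%:E.
Proof.
rewrite integral_indic// setIidl; first exact: atomE.
by move=> x ->; rewrite /D/= in_itv/= ler01 lexx.
Qed.

Lemma moment_le1 p : moment p <= 1.
Proof.
rewrite -lee_fin momentE.
have <- : (\int[mu]_(x in D) (cst 1 x))%E = 1%E.
  by rewrite integral_cst//= mul1e; exact: mu_supp.
apply: ge0_le_integral => // x Dx; have /andP[x0 x1] := Dpow p Dx; by rewrite lee_fin.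
Qed.

Lemma atom_le_moment p : atom <= moment p.
Proof.
rewrite -lee_fin momentE -integral_atom.
apply: ge0_le_integral => //.
- by apply/measurable_EFinP; exact: measurable_indic.
- move=> x Dx; have /andP[x0 x1] := Dpow p Dx; rewrite lee_fin indicE.
  by case: (boolP (x \in _)) => //; rewrite inE => ->; rewrite expr1n.
Qed.

(** On [0, 1] the powers converge pointwise to the indicator of [1], under the
constant bound [1]. *)
Lemma cvg_moment : moment @ \oo --> atom.
Proof.
suff : EFin \o moment @ \oo --> atom%:E by exact: fine_cvg.
rewrite -integral_atom.
rewrite (_ : EFin \o _ =
  fun p => (\int[mu]_(x in D) (x ^+ p)%:E)%E); last first.
  by apply/funext => p; rewrite /= momentE.
have [] // := @dominated_convergence _ _ _ mu D mD
  (fun p x => (x ^+ p)%:E) (fun x => (\1_[set 1%R : measurableTypeR R] x)%:E) (cst 1%E).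
- by apply/measurable_EFinP; exact: measurable_indic.
- apply: aeW => x; rewrite /D/= in_itv/= => /andP[x0 x1].
  apply: cvg_EFin; first by near=> n.
  have [->|xn1] := eqVneq x 1.
    by rewrite indicE mem_set//; apply: cvg_near_cst; near=> n; exact: expr1n.
  rewrite indicE memNset; last exact/eqP.
  by apply: cvg_expr; rewrite ger0_norm// lt_neqAle xn1.
- apply: aeW => x p Dx; have /andP[x0 x1] := Dpow p Dx.
  by rewrite /= lee_fin ger0_norm.
Unshelve. all: by end_near. Qed.

End Moments.

(** * Abel's theorem and the behaviour of psi at 1 *)

Section Abel.
Variable R : realType.

Lemma geometric_sum_le (z : R) m n : 0 <= z < 1 ->
  \sum_(m <= i < n) z ^+ i <= (1 - z)^-1.
Proof.
move=> /andP[z0 z1].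
apply: (@le_trans _ _ (\sum_(0 <= i < n) z ^+ i)).
  have [mn|/ltnW nm] := leqP m n.
    rewrite [leRHS](@big_cat_nat _ _ _ m)//= lerDr sumr_ge0// => i _.
    by rewrite exprn_ge0.
  by rewrite big_geq// sumr_ge0// => i _; rewrite exprn_ge0.
have /(congr1 (fun u => u n)) := geometric_seriesE 1 (negbT (lt_eqF z1)).
rewrite /series /= => E; under eq_bigr do rewrite -[_ ^+ _]mul1r.
rewrite E mul1r ler_pdivrMr ?subr_gt0// mulVf ?gt_eqF ?subr_gt0//.
by rewrite lerBlDr lerDl exprn_ge0.
Qed.

(** The first [N] coefficients contribute a constant; the others contribute at most
a geometric series. *)
Lemma abel_bound (u : R^nat) (v z e : R) N : 0 <= z < 1 -> 0 <= e ->
  (forall n, (N <= n)%N -> `|u n| <= e) -> pseries u z @ \oo --> v ->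
  `|v| <= \sum_(0 <= i < N) `|u i| + e * (1 - z)^-1.
Proof.
move=> z01 e0 uN uv; have /andP[z0 z1] := z01.
apply: (cvgr_to_le (cvg_norm uv)); near=> n.
have Nn : (N <= n)%N by near: n; exists N.
rewrite /pseries /series /= (@big_cat_nat _ _ _ N)//=.
rewrite (le_trans (ler_normD _ _))// lerD//.
  rewrite (le_trans (ler_norm_sum _ _ _))// ler_sum// => i _.
  by rewrite normrM ler_piMr// normrX exprn_ile1// ger0_norm// ltW.
apply: (@le_trans _ _ (e * \sum_(N <= i < n) z ^+ i)); last first.
  by rewrite ler_wpM2l// geometric_sum_le.
rewrite mulr_sumr (le_trans (ler_norm_sum _ _ _))// ler_sum_nat// => i /andP[Ni _].
by rewrite normrM normrX (ger0_norm z0) ler_wpM2r ?exprn_ge0// uN.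
Unshelve. all: by end_near. Qed.

(** A constant sequence [l] sums to [l / (1 - z)], so that the claim concerns the
sequence [c - l], which tends to [0].  Splitting its series at a large rank,
the factor [1 - z] kills the finite part and cancels the [1 / (1 - z)] of the
rest. *)
Lemma abel_limit (c : R^nat) (f : R -> R) (l : R) :
  (forall z, 0 <= z < 1 -> pseries c z @ \oo --> f z) ->
  c @ \oo --> l -> (1 - z) * f z @[z --> 1^'-] --> l.
Proof.
move=> cf cl; apply/cvgrPdist_le => e e0.
have /(cvgrPdist_le _ _).1 /(_ (e / 2)) := cl.
rewrite divr_gt0// => /(_ isT)[N _ cN].
pose u n := c n - l; pose C := \sum_(0 <= i < N) `|u i|.
have C0 : 0 <= C by exact: sumr_ge0.
near=> z.
have z01 : 0 <= z < 1.
  by apply/andP; split; near: z; [exact: nbhs_left_ge|exact: nbhs_left_lt].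
have /andP[z0 z1] := z01; have z1' : 0 < 1 - z by rewrite subr_gt0.
have zC : (1 - z) * C <= e / 2.
  (* [C] may be zero, hence the denominator [C + 1] *)
  have : 1 - z <= (e / 2) / (C + 1).
    rewrite lerBlDr -lerBlDl; near: z; apply: nbhs_left_ge.
    by rewrite ltrBlDr ltrDl divr_gt0 ?divr_gt0// ltr_wpDl.
  rewrite ler_pdivlMr; last by rewrite ltr_wpDl.
  nra.
have uv : pseries u z @ \oo --> f z - l * (1 - z)^-1.
  rewrite (_ : pseries u z = pseries c z \- series (geometric l z)).
    apply: cvgB; first exact: cf.
    by apply: cvg_geometric_series; rewrite ger0_norm.
  apply/funext => n; rewrite /pseries /series /= -sumrB.
  by apply: eq_bigr => i _; rewrite mulrBl.
have e20 : 0 <= e / 2 by rewrite divr_ge0// ltW.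
have := abel_bound z01 e20 _ uv (N := N).
have uN n : (N <= n)%N -> `|u n| <= e / 2.
  by move=> Nn; rewrite distrC; exact: cN.
move=> /(_ uN) H; rewrite distrC.
have -> : (1 - z) * f z - l = (1 - z) * (f z - l * (1 - z)^-1).
  by field; rewrite gt_eqF.
rewrite normrM (gtr0_norm z1').
apply: (le_trans (ler_wpM2l (ltW z1') H)).
rewrite mulrDr [_ * (e / 2 * _)]mulrCA divff ?gt_eqF// mulr1.
by rewrite [leRHS](splitr e) lerD2r.
Unshelve. all: by end_near. Qed.

End Abel.
Section Psi.
Variables (R : realType) (mu : probability (measurableTypeR R) R).
Hypothesis mu_supp : mu (`[0, 1]%classic : set R) = 1%E.
Local Notation m := (moment mu).

Lemma moment0 : m 0%N = 1.
Proof.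
rewrite /moment /Rintegral; under eq_integral do rewrite expr0.
by rewrite integral_cst//= mul1e probability_setT.
Qed.

Lemma moment_ge0 n : 0 <= m n.
Proof. by rewrite (le_trans _ (atom_le_moment mu_supp n))// fine_ge0. Qed.

(** The series [psi] starts at degree 1, and the moment of order 0 is [1]. *)
Lemma cvg_pseries_moment z : `|z| < 1 -> pseries m z @ \oo --> 1 + psi mu z.
Proof.
move=> z1.
have cm : cvgn (pseries m z).
  apply: normed_cvg.
  apply: (@series_le_cvg _ _ (geometric 1 `|z|)).
  - by move=> n /=.
  - by move=> n /=; rewrite mul1r exprn_ge0.
  - move=> n /=; rewrite normrM normrX ler_wpM2r ?exprn_ge0//.
    rewrite ger0_norm ?moment_le1//.
    exact: moment_ge0.
  - by apply: is_cvg_geometric_series; rewrite normr_id.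
suff -> : 1 + psi mu z = limn (pseries m z) by [].
have -> : psi mu z = limn (pseries m z) - 1; last by rewrite addrC subrK.
apply/cvg_lim => //; rewrite -cvg_shiftS.
rewrite (_ : (fun _ => _) = fun n => pseries m z n.+1 - 1).
  by apply: cvgB; [rewrite (cvg_shiftS (pseries m z))|exact: cvg_cst].
apply/funext => n; rewrite /pseries /series big_add1 /=.
rewrite [in RHS]big_nat_recl//= moment0 expr0 mul1r.
rewrite addrC addKr.
by apply: eq_bigr => i _; rewrite mulrC.
Qed.

Lemma unit_pseries_psi : unit_pseries (psi mu).
Proof.
apply: (@eq_unit_pseries _ (fun z => -1 + (1 + psi mu z))).
  by move=> z _; rewrite addKr.
apply: unit_pseriesD; first exact: unit_pseries_cst.
by exists m => z; exact: cvg_pseries_moment.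
Qed.

Lemma psi_ge0 z : 0 <= z < 1 -> 0 <= psi mu z.
Proof.
move=> /andP[z0 z1]; rewrite -(lerD2l 1) addr0.
have /cvg_pseries_moment : `|z| < 1 by rewrite ger0_norm.
move=> /cvgr_to_ge; apply; exists 1%N => // n /= n0.
rewrite -(prednK n0) /pseries /series /= big_nat_recl//= moment0 expr0 mulr1 lerDl.
rewrite sumr_ge0// => i _; rewrite mulr_ge0 ?exprn_ge0//.
exact: moment_ge0.
Qed.

Lemma psi0 : psi mu 0 = 0.
Proof.
have /cvg_pseries_moment : `|0 : R| < 1 by rewrite normr0.
move=> /cvg_unique /(_ (@pseries_at0 _ m)); rewrite moment0 => H.
by apply: (addrI 1); rewrite addr0; exact: H.
Qed.

Lemma cvg_psi_atom :
  (1 - z) * (1 + psi mu z) @[z --> 1^'-] --> fine (mu [set (1 : R)]).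
Proof.
apply: abel_limit (cvg_moment mu_supp) => z /andP[z0 z1].
by apply: cvg_pseries_moment; rewrite ger0_norm.
Qed.

End Psi.

(** * From the S-transform to a functional equation on the unit interval *)

Section FunctionalEquation.
Variables (R : realType) (tau : R).
Implicit Types (psi dpsi : R -> R) (z : R).

(** The germ [chi] is evaluated at [psi z], where it returns [z].  The formula for
[chi] is only known away from [0]; where [psi] vanishes, [z = chi 0 = 0] and
both sides are zero. *)
Lemma functional_equation_near0 psi chi : psi 0 = 0 -> {for 0, continuous psi} ->
  inverse_near0 psi chi ->
  (\forall w \near 0^', expR (tau / (1 + w)) = (1 + w) / w * chi w) ->
  \forall z \near 0, psi z * expR (tau / (1 + psi z)) = z * (1 + psi z).
Proof.
move=> psi0 cpsi [chi0 _ _ chipsi] S.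
have {}S : \forall z \near 0, psi z != 0 ->
    expR (tau / (1 + psi z)) = (1 + psi z) / psi z * chi (psi z).
  apply: (cpsi (fun w => w != 0 -> expR (tau / (1 + w)) = (1 + w) / w * chi w)).
  by rewrite psi0; exact: S.
near=> z.
have chiz : chi (psi z) = z by near: z.
have [pz|pz] := eqVneq (psi z) 0.
  by rewrite pz mul0r -chiz pz chi0 mul0r.
have -> : expR (tau / (1 + psi z)) = (1 + psi z) / psi z * chi (psi z).
  by move: pz; near: z.
by rewrite chiz mulrA mulrCA divff// mulr1 mulrC.
Unshelve. all: by end_near. Qed.

Lemma is_derive_chi_comp psi z p' : 1 + psi z != 0 -> is_derive z 1 psi p' ->
  is_derive z 1 (fun y => psi y * expR (tau / (1 + psi y)))
    (p' * expR (tau / (1 + psi z)) * (1 - tau * psi z / (1 + psi z) ^+ 2)).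
Proof.
move=> pz dpsi.
have d1 : is_derive z 1 (fun y => 1 + psi y) p'.
  by have := is_deriveD (is_derive_cst (1 : R) z 1) dpsi; rewrite add0r.
have d2 := @is_deriveV R (fun y => 1 + psi y) _ _ _ pz d1.
have d3 : is_derive z 1 (fun y => tau / (1 + psi y)) (tau * (- (1 + psi z) ^- 2 *: p')).
  by have := is_deriveZ tau d2.
have d4 := @is_derive1_comp R expR (fun y => tau / (1 + psi y)) _ _ _
  (is_derive_expR _) d3.
apply: (is_derive_eq (is_deriveM dpsi d4)).
by rewrite /GRing.scale /=; field.
Qed.

(** Differentiating the functional equation gives an identity in which the
exponential occurs linearly; the equation itself eliminates it. *)
Lemma psi_ode_near0 psi psi' : psi 0 = 0 -> {for 0, continuous psi} ->
  (\forall z \near (0 : R), is_derive z (1 : R) psi (psi' z)) ->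
  (\forall z \near 0, psi z * expR (tau / (1 + psi z)) = z * (1 + psi z)) ->
  \forall z \near 0, z * (psi' z * (1 + (1 - tau) * psi z)) =
     psi z * ((1 + psi z) * (1 + psi z)).
Proof.
move=> psi0 cpsi dpsi E; near=> z.
have pz : 1 + psi z != 0.
  suff : `|psi z| < 1.
    by by rewrite ltr_norml => /andP[? _]; rewrite gt_eqF//; lra.
  near: z; apply: (cvgr_norm_lt (psi 0)); first exact: cpsi.
  by rewrite psi0 normr0.
have dz : is_derive z 1 psi (psi' z) by near: z.
have Ez : psi z * expR (tau / (1 + psi z)) = z * (1 + psi z) by near: z.
have dL := is_derive_chi_comp pz dz.
have dR : is_derive z 1 (fun y => y * (1 + psi y)) ((1 + psi z) + z * psi' z).
  apply: (is_derive_eq (is_deriveM (is_derive_id z 1)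
    (is_deriveD (is_derive_cst (1 : R) z 1) dz))).
  by rewrite /GRing.scale /= add0r mulr1 addrC.
have : psi' z * expR (tau / (1 + psi z)) * (1 - tau * psi z / (1 + psi z) ^+ 2) =
    (1 + psi z) + z * psi' z.
  have [_ <-] := dL; have [_ <-] := dR; apply: near_eq_derive.
  by near: z; exact: near_join E.
move: Ez pz; move: (psi z) (psi' z) (expR _) => p p' e Ez pz H.
apply/eqP; rewrite -subr_eq0; apply/eqP.
(* a combination of the differentiated equation and of the equation itself,
   with multipliers chosen to cancel the terms in [e] *)
rewrite [LHS](_ : _ =
  p * (1 + p) * (p' * e * (1 - tau * p / (1 + p) ^+ 2) - (1 + p + z * p')) -
  p' * (1 + p) * (1 - tau * p / (1 + p) ^+ 2) * (p * e - z * (1 + p))).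
  by rewrite H Ez !subrr !mulr0 subrr.
by field.
Unshelve. all: by end_near. Qed.

(** Analytic continuation through the differential equation, which, unlike the
functional equation, is polynomial in [z], [psi] and [psi'] and so lies within
reach of the identity principle. *)
Lemma functional_equation psi : unit_pseries psi -> psi 0 = 0 ->
  (forall z, 0 <= z < 1 -> 0 <= psi z) ->
  (\forall z \near 0, psi z * expR (tau / (1 + psi z)) = z * (1 + psi z)) ->
  forall z, 0 <= z < 1 -> psi z * expR (tau / (1 + psi z)) = z * (1 + psi z).
Proof.
move=> upsi psi0 psi_ge0 E.
have [psi' upsi' dpsi] := is_derive_unit_pseries upsi.
have ode z : `|z| < 1 -> z * (psi' z * (1 + (1 - tau) * psi z)) =
     psi z * ((1 + psi z) * (1 + psi z)).
  pose defect z := z * (psi' z * (1 + (1 - tau) * psi z)) +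
    (-1) * (psi z * ((1 + psi z) * (1 + psi z))).
  suff defect0 y : `|y| < 1 -> defect y = 0.
    by move=> /defect0; rewrite /defect mulN1r => /eqP; rewrite subr_eq0 => /eqP.
  apply: (@unit_pseries_identity _ defect).
    have u1 : unit_pseries (fun z => 1 + psi z).
      by apply: unit_pseriesD => //; exact: unit_pseries_cst.
    apply: unit_pseriesD; apply: unit_pseriesM => //.
    - exact: unit_pseries_id.
    - apply: unit_pseriesM => //; apply: unit_pseriesD; first exact: unit_pseries_cst.
      by apply: unit_pseriesM => //; exact: unit_pseries_cst.
    - exact: unit_pseries_cst.
    - by apply: unit_pseriesM => //; exact: unit_pseriesM.
  have : \forall z \near 0, z * (psi' z * (1 + (1 - tau) * psi z)) =
     psi z * ((1 + psi z) * (1 + psi z)).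
    apply: psi_ode_near0 => //.
      have d0 := dpsi 0; rewrite normr0 ltr01 in d0.
      by apply/differentiable_continuous/derivable1_diffP; case: (d0 isT).
    by near=> t; apply: dpsi; near: t; apply: near_norm_lt1; rewrite normr0.
  by apply: filterS => x; rewrite /defect => ->; rewrite mulN1r subrr.
(* [Q] is the quotient of the two sides; the differential equation says exactly
   that its derivative is zero *)
pose Q z := psi z * expR (tau / (1 + psi z)) / (z * (1 + psi z)).
have pz z : 0 < z < 1 -> 1 + psi z != 0.
  by move=> /andP[z0 z1]; rewrite gt_eqF// ltr_wpDr// psi_ge0// z1 ltW.
have dQ z : 0 < z < 1 -> is_derive z 1 Q 0.
  move=> z01; have /andP[z0 z1] := z01; have pz0 := pz z z01.
  have z0' : z != 0 by rewrite gt_eqF.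
  have dz : is_derive z 1 psi (psi' z) by apply: dpsi; rewrite gtr0_norm.
  have dL := is_derive_chi_comp pz0 dz.
  have dR : is_derive z 1 (fun y => y * (1 + psi y)) ((1 + psi z) + z * psi' z).
    apply: (is_derive_eq (is_deriveM (is_derive_id z 1)
      (is_deriveD (is_derive_cst (1 : R) z 1) dz))).
    by rewrite /GRing.scale /= add0r mulr1 addrC.
  have dV := @is_deriveV R (fun y => y * (1 + psi y)) _ _ _ (mulf_neq0 z0' pz0) dR.
  apply: (is_derive_eq (is_deriveM dL dV)); rewrite /GRing.scale /=.
  have := ode z; rewrite gtr0_norm// => /(_ z1).
  move: z0' pz0; move: (psi z) (psi' z) (expR _) => p p' e z0' pz0 /eqP.
  rewrite -subr_eq0 => /eqP O.
  rewrite [LHS](_ : _ =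
    e * (z * (p' * (1 + (1 - tau) * p)) - p * ((1 + p) * (1 + p)))
    / (z ^+ 2 * (1 + p) ^+ 3)).
    by rewrite O mulr0 mul0r.
  by field; rewrite z0' pz0.
move=> z /andP[]; rewrite le_eqVlt => /predU1P[<- _|z0 z1].
  by rewrite psi0 !mul0r.
have [x [x0 xz Ex]] : exists x, [/\ 0 < x, x < z
    & psi x * expR (tau / (1 + psi x)) = x * (1 + psi x)].
  apply: (@filter_ex _ (0 : R)^'+); near=> x; split; near: x.
  - exact: nbhs_right_gt.
  - exact: nbhs_right_lt.
  - exact: cvg_within E.
have x01 : 0 < x < 1 by rewrite x0 (lt_trans xz).
have z01 : 0 < z < 1 by rewrite z0 z1.
have dQxz y : x <= y -> y <= z -> is_derive y 1 Q 0.
  by move=> xy yz; apply: dQ; rewrite (lt_le_trans x0)// (le_lt_trans yz).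
have dQ' y : y \in `]x, z[ -> is_derive y 1 Q (cst 0 y).
  by rewrite in_itv/= => /andP[/ltW xy /ltW yz]; exact: dQxz.
have cQ : {within `[x, z], continuous Q}.
  apply: derivable_within_continuous => y; rewrite in_itv/= => /andP[xy yz].
  by case: (dQxz y xy yz).
have [c _] := MVT_segment (ltW xz) dQ' cQ.
rewrite mul0r => /eqP; rewrite subr_eq0 => /eqP QE.
have : Q z = 1.
  by rewrite QE /Q Ex divff// mulf_neq0 ?pz// gt_eqF.
by move=> /divr1_eq.
Unshelve. all: by end_near. Qed.

End FunctionalEquation.

(** * The atom at 1 *)

Section Atom.
Variables (R : realType) (tau : R).
Hypothesis tau0 : 0 < tau.

(** With [u = tau / (1 + p) < 1], this comes from [expR u <= 1 / (1 - u)] and from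
[tau * (1 - tau) >= 0]. *)
Lemma residue_ge z p : tau < 1 -> 0 <= p ->
  p * expR (tau / (1 + p)) = z * (1 + p) -> 1 - tau <= (1 - z) * (1 + p).
Proof.
move=> tau1 p0 E.
have h0 : 0 < 1 + p by rewrite ltr_wpDr.
have ht : 0 < 1 + p - tau by lra.
suff : p * expR (tau / (1 + p)) <= p + tau by rewrite mulrBl mul1r -E; lra.
rewrite -(ler_pM2r ht).
have /(ler_wpM2l (expR_ge0 (tau / (1 + p)))) := expR_ge1Dx (- (tau / (1 + p))).
rewrite expRxMexpNx_1 => /(ler_wpM2l (mulr_ge0 p0 (ltW h0))).
rewrite (_ : p * (1 + p) * _ = p * expR (tau / (1 + p)) * (1 + p - tau)).
  move=> /le_trans; apply.
  have : 0 <= tau * (1 - tau) by apply: mulr_ge0; rewrite ?subr_ge0 ltW.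
  nra.
by field; rewrite gt_eqF.
Qed.

(** From [expR u >= 1 + u] with [u = tau / (1 + p)]. *)
Lemma residue_le z p : 0 <= p -> p * expR (tau / (1 + p)) = z * (1 + p) ->
  (1 - z) * (1 + p) <= 1 - tau + tau / (1 + p).
Proof.
move=> p0 E.
have h0 : 0 < 1 + p by rewrite ltr_wpDr.
have := expR_ge1Dx (tau / (1 + p)).
rewrite mulrBl mul1r -E => H.
have := ler_wpM2l p0 H.
rewrite (_ : p * (1 + _) = p + tau - tau / (1 + p)).
  lra.
by field; rewrite gt_eqF.
Qed.

(** The limit [a] of [(1 - z) * (1 + psi z)] satisfies [a >= 1 - tau] if [tau < 1]
and [a * a <= (1 - tau) * a]; this forces its value. *)
Lemma atom_mass (mu : probability (measurableTypeR R) R) :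
  mu (`[0, 1]%classic : set R) = 1%E ->
  has_S_transform mu (fun z => expR (tau / (1 + z))) ->
  mu [set (1 : R)] = (Num.max (1 - tau) 0)%:E.
Proof.
move=> mu_supp [_ [chi psichi S]].
pose a := fine (mu [set (1 : R)]).
have a0 : 0 <= a by exact: fine_ge0.
have upsi := unit_pseries_psi mu_supp.
have p0 := psi0 mu_supp.
have cpsi : {for 0, continuous (psi mu)}.
  have [psi' _ dpsi] := is_derive_unit_pseries upsi.
  have d0 := dpsi 0; rewrite normr0 ltr01 in d0.
  by apply/differentiable_continuous/derivable1_diffP; case: (d0 isT).
have E := functional_equation upsi p0 (@psi_ge0 _ _ mu_supp)
  (functional_equation_near0 p0 cpsi psichi S).
have Aa := cvg_psi_atom mu_supp; rewrite -/a in Aa.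
have near1 : \forall z \near (1 : R)^'-, 0 <= z < 1.
  near=> z; apply/andP; split; near: z; [exact: nbhs_left_ge|exact: nbhs_left_lt].
have ge_a : tau < 1 -> 1 - tau <= a.
  move=> tau1; apply: (cvgr_to_ge Aa); near=> z.
  have z01 : 0 <= z < 1 by near: z.
  by apply: residue_ge => //; [exact: psi_ge0|exact: E].
(* multiplying the upper bound by [(1 - z) * (1 + psi z)] turns its error term
   [tau / (1 + psi z)] into [tau * (1 - z)], which is known to tend to 0 *)
have le_a : a * a <= (1 - tau) * a + tau * (1 - 1).
  have cr : (1 - tau) * ((1 - z) * (1 + psi mu z)) + tau * (1 - z) @[z --> 1^'-]
      --> (1 - tau) * a + tau * (1 - 1).
    apply: cvgD; first exact: cvgMr.
    apply: cvgMr; apply: cvgB; first exact: cvg_cst.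
    by apply: cvg_within; exact: cvg_id.
  apply: (ler_cvg_to (cvgM Aa Aa) cr); near=> z.
  have z01 : 0 <= z < 1 by near: z.
  have /andP[z0 z1] := z01; have pz := psi_ge0 mu_supp z01.
  have h0 : 0 < 1 + psi mu z by rewrite ltr_wpDr.
  have := residue_le pz (E z z01).
  have A0 : 0 <= (1 - z) * (1 + psi mu z) by rewrite mulr_ge0 ?subr_ge0// ltW.
  move=> /(ler_wpM2r A0); rewrite [leRHS]mulrDl => /le_trans; apply.
  by rewrite lerD2l (_ : _ / _ * _ = tau * (1 - z))//; field; rewrite gt_eqF.
rewrite atomE -/a; congr (_%:E); rewrite subrr mulr0 addr0 in le_a.
clear mu_supp E Aa near1; clearbody a.
have [tau1|tau1] := leP 1 tau.
  rewrite max_r ?subr_le0//; apply/eqP; rewrite eq_le a0 andbT leNgt.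
  by apply/negP => ap; nra.
rewrite max_l ?subr_ge0 ?ltW//; apply/eqP; rewrite eq_le ge_a// andbT leNgt.
by apply/negP => ap; nra.
Unshelve. all: by end_near. Qed.

End Atom.

(** * The branch point *)

Section Branch.
Variable R : realType.
Implicit Types tau : R.

(** The derivative of [zmap tau] at [h] is proportional to
[(h + tau) * (h - 1) - h ^+ 2 = (tau - 1) * h - tau]. *)
Lemma branch_point tau : 0 < tau -> tau != 1 -> real_branch_point tau (xstar tau).
Proof.
move=> tau0 tau1.
have t1 : tau - 1 != 0 by rewrite subr_eq0.
have t0 : tau != 0 by rewrite gt_eqF.
have [h hE] : exists h, h = tau / (tau - 1) by eexists.
have h0 : h != 0 by rewrite hE mulf_neq0 ?invr_eq0.
have hB1 : h - 1 = (tau - 1)^-1 by rewrite hE; field.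
have h1 : h - 1 != 0 by rewrite hB1 invr_eq0.
have th : - (tau / h) = 1 - tau by rewrite hE; field; rewrite t0 t1.
exists h; split=> //.
- by rewrite -subr_eq0.
- have dV := @is_deriveV R id _ _ _ h0 (is_derive_id h 1).
  have dE := @is_derive1_comp R expR (fun y => - (tau / y)) _ _ _ (is_derive_expR _)
    (is_deriveN (is_deriveZ tau dV)).
  have dB := @is_deriveV R (fun y => y - 1) _ _ _ h1
    (is_deriveB (is_derive_id h 1) (is_derive_cst (1 : R) h 1)).
  apply: (is_derive_eq (is_deriveM (is_deriveM (is_derive_id h 1) dE) dB)).
  rewrite /GRing.scale /= subr0 !mulr1.
  rewrite [(id * _) h](_ : _ = h * expR (- (tau / h)))//.
  move: (expR _) => e.
  rewrite [LHS](_ : _ = e * ((h + tau) * (h - 1) - h ^+ 2) / (h * (h - 1) ^+ 2)).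
    rewrite (_ : (h + tau) * _ - _ = 0) ?mulr0 ?mul0r//.
    by rewrite hB1 hE; field.
  by field; rewrite h0 h1.
- rewrite /zmap th hB1 invrK /xstar hE; field.
  done.
Qed.

Lemma cvg_xstar tau : xstar s @[s --> tau^'] --> xstar tau.
Proof.
have id_cvg : s @[s --> tau^'] --> tau by apply: cvg_within; exact: cvg_id.
apply: cvgM; first exact: id_cvg.
apply: continuous_cvg; first exact: continuous_expR.
by apply: cvgB; [exact: cvg_cst|exact: id_cvg].
Qed.

End Branch.

Theorem proposition11 (R : realType) (tau : R) (tau_gt0 : 0 < tau)
    (mu : probability (measurableTypeR R) R)
    (mu_supp : mu (`[0, 1]%classic : set R) = 1%E)
    (mu_S : has_S_transform mu (fun z : R => expR (tau / (1 + z)))) :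
  (mu [set (1%R : R)] = (Num.max (1 - tau) 0)%:E /\
   mu (`[0, 1]%classic `\ (1 : R)) = (Num.min 1 tau)%:E) /\
  ((tau != 1 -> real_branch_point tau (xstar tau)) /\
   (tau = 1 ->
     (\forall s \near tau^', real_branch_point s (xstar s)) /\
     xstar s @[s --> tau^'] --> xstar tau)) /\
  (xstar (1 : R) = 1 /\
   (tau < 1 -> (0 < mu [set (1%R : R)])%E) /\
   (1 <= tau -> mu [set (1%R : R)] = 0%E)).
Proof.
have atom := atom_mass tau_gt0 mu_supp mu_S.
split; [split=> //|split; split].
- have mD := measureD (mu := mu) (measurable_itv `[0, 1]) (measurable_set1 (1 : R)).
  rewrite mD; last first.
    by apply: le_lt_trans (ltry (1 : R)); rewrite le_eqVlt; apply/orP; left; exact/eqP.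
  rewrite setIidr; last by move=> x ->; rewrite /= in_itv/= ler01 lexx.
  transitivity (1 - (Num.max (1 - tau) 0)%:E)%E.
    by congr (_ - _)%E; [exact: mu_supp|exact: atom].
  rewrite -EFinB; congr (_%:E); rewrite /Order.max /Order.min.
  by case: ifPn; case: ifPn; lra.
- exact: branch_point.
- move=> tau1; split; last exact: cvg_xstar.
  near=> s; apply: branch_point.
    by near: s; apply: nbhs_dnbhs; exact: lt_nbhsr.
  by rewrite -tau1; near: s; exact: nbhs_dnbhs_neq.
- by rewrite /xstar subrr expR0 mulr1.
- rewrite atom; split=> tau1.
    by rewrite lte_fin lt_max subr_gt0 tau1.
  by rewrite max_r// subr_le0.
Unshelve. all: by end_near. Qed.
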